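(* Let $\Gamma=(V,E)$ be a reflexive locally finite vertex-transitive graph such that both $\Gamma$ and $\Gamma^-$ are degenerate. Then one of the following holds: (i) one of the graphs $\Gamma$ and $\Gamma^-$ is not a Cauchy graph, and either a $1$-atom of $\Gamma$ or a $1$-atom of $\Gamma^-$ is a block; (ii) one of the graphs $\Gamma$ and $\Gamma^-$ is not $2$-faithful, and a $2$-super-fragment of the reverse of that graph is a block; (iii) $\Gamma$ and $\Gamma^-$ are $2$-faithful Cauchy graphs and no vertex belongs to three distinct $2$-atoms of $\Gamma$ and to three distinct $2$-atoms of $\Gamma^-$; (iv) the $2$-atoms of $\Gamma$ or the $2$-atoms of $\Gamma^-$ have cardinality $2$.
   Context: A graph is a pair $\Gamma=(V,E)$ with $E\subseteq V\times V$; reflexive means $(x,x)\in E$ for all $x$; $\Gamma(x)=\{y:(x,y)\in E\}$, $\Gamma(X)=\bigcup_{x\in X}\Gamma(x)$; the reverse graph is $\Gamma^-=(V,E^-)$, $E^-=\{(x,y):(y,x)\in E\}$; locally finite means $\Gamma(x)$, $\Gamma^-(x)$ finite for all $x$. An automorphism is a bijection $f:V\to V$ with $\Gamma(f(x))=f(\Gamma(x))$ for all $x$; $\Gamma$ is vertex-transitive if for all $x,y$ some automorphism maps $x$ to $y$. A block is a set $B\subseteq V$ such that for every automorphism $f$, either $f(B)=B$ or $f(B)\cap B=\emptyset$. $\partial(X)=\Gamma(X)\setminus X$, $\nabla(X)=V\setminus\Gamma(X)$. $\Gamma$ is $k$-separable if there is a finite $X$ with $|X|\ge k$, $|\nabla(X)|\ge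 k$; then $\kappa_k(\Gamma)=\min\{|\partial(X)|: X\text{ finite},|X|\ge k,|\nabla(X)|\ge k\}$. A $k$-fragment is a finite $X$ with $|X|\ge k$, $|\nabla(X)|\ge k$, $|\partial(X)|=\kappa_k(\Gamma)$; a $k$-atom is a $k$-fragment of minimum cardinality; when $V$ is finite a $k$-super-fragment is a $k$-fragment of maximum cardinality. A graph is $k$-faithful if $|A|\le|\nabla(A)|$ for a $k$-atom $A$; a Cauchy graph if it is not $1$-separable or it has a $1$-atom $A$ with $|A|=1$ or $|\nabla(A)|=1$; degenerate if it is $2$-separable and $\kappa_2=\kappa_1$. All notions for $\Gamma^-$ are defined by replacing $\Gamma$ with $\Gamma^-$. *)

(* Defs.v *)
From Stdlib Require Import List.
Import ListNotations.

Section GraphDefs.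
Variable V : Type.

Definition vset := V -> Prop.

Definition card (S : vset) (n : nat) : Prop :=
  exists l : list V, NoDup l /\ length l = n /\ forall x, S x <-> In x l.

Definition finite (S : vset) : Prop := exists n, card S n.

Definition atleast (k : nat) (S : vset) : Prop :=
  exists l : list V, NoDup l /\ length l = k /\ forall x, In x l -> S x.

(* |A| <= |B| for A finite (B possibly infinite) *)
Definition card_le (A B : vset) : Prop :=
  forall n, card A n -> atleast n B.

Definition set_eq (A B : vset) : Prop := forall x, A x <-> B x.

Variable E : V -> V -> Prop.

Definition rev_graph : V -> V -> Prop := fun x y => E y x.

Definition reflexive_graph : Prop := forall x, E x x.

Definition nbr (x : V) : vset := fun y => E x y.
Definition nbrs (X : vset) : vset := fun y => exists x, X x /\ E x y.

Definition locally_finite : Prop :=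
  forall x, finite (fun y => E x y) /\ finite (fun y => E y x).

Definition image (f : V -> V) (X : vset) : vset := fun y => exists x, X x /\ f x = y.

Definition automorphism (f : V -> V) : Prop :=
  (exists g : V -> V, (forall x, g (f x) = x) /\ (forall y, f (g y) = y)) /\
  forall x, set_eq (nbr (f x)) (image f (nbr x)).

Definition vertex_transitive : Prop :=
  forall x y, exists f, automorphism f /\ f x = y.

Definition block (B : vset) : Prop :=
  forall f, automorphism f ->
    set_eq (image f B) B \/ (forall y, ~ (image f B y /\ B y)).

Definition bdry (X : vset) : vset := fun y => nbrs X y /\ ~ X y.
Definition ext (X : vset) : vset := fun y => ~ nbrs X y.

Definition admissible (k : nat) (X : vset) : Prop :=
  finite X /\ atleast k X /\ atleast k (ext X).

Definition separable (k : nat) : Prop := exists X, admissible k X.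

Definition is_kappa (k n : nat) : Prop :=
  (exists X, admissible k X /\ card (bdry X) n) /\
  (forall Y m, admissible k Y -> card (bdry Y) m -> n <= m).

Definition fragment (k : nat) (X : vset) : Prop :=
  admissible k X /\ exists n, is_kappa k n /\ card (bdry X) n.

Definition atom (k : nat) (A : vset) : Prop :=
  fragment k A /\ exists a, card A a /\
    forall B b, fragment k B -> card B b -> a <= b.

Definition super_fragment (k : nat) (F : vset) : Prop :=
  finite (fun _ => True) /\
  fragment k F /\ exists a, card F a /\
    forall B b, fragment k B -> card B b -> b <= a.

Definition faithful (k : nat) : Prop :=
  exists A, atom k A /\ card_le A (ext A).

Definition cauchy : Prop :=
  ~ separable 1 \/
  exists A, atom 1 A /\ (card A 1 \/ card (ext A) 1).

Definition degenerate : Prop :=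
  separable 2 /\ exists n, is_kappa 2 n /\ is_kappa 1 n.

End GraphDefs.

Arguments rev_graph {V} E _ _.

(* Main.v *)
From mathcomp Require Import all_boot finmap zify.
From mathcomp.classical Require Import boolp.
Require Import Defs.

(** The set [T = Gamma^-(B)] of a 2-atom [B] of the reverse graph interacts with
    the 2-atoms of the graph as follows.  In the case left over once (i) and (ii)
    are excluded, [kappa_1 = kappa_2 = d - 1] in both directions, so distinct
    2-atoms meet in at most one vertex, and two 2-atoms [B1], [B2] of the reverse
    graph through [y] satisfy [Gamma^-(B1) cap Gamma^-(B2) = Gamma^-(y)].  Let
    [a <= b] be the sizes of the 2-atoms of the graph and of its reverse.
    Counting the boundary of [B \ Gamma(A)] shows that a 2-atom [A] meeting [T] has
    at most one vertex outside [T], and that if it has exactly one ("tangent") then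
    [a = b] and [T \ A = Gamma^-(y)] for some [y] in [B].  Some tangent pair
    [(A, B1)] exists, as otherwise [Gamma(x)] would be constant along 2-atoms.  With
    its [y] and another [B2] through [y], every 2-atom other than [A] through a
    vertex of [A cap Gamma^-(B1)] is tangent to [Gamma^-(B2)].  Different tangents
    yield different vertices of [B2], so [2(a - 1) <= a], contradicting [a >= 3]. *)

Set Implicit Arguments.
Unset Strict Implicit.

Local Open Scope fset_scope.
Local Open Scope nat_scope.

(** * Fragments and atoms over finite sets *)

Section FsetNeighbourhoods.
Variable K : choiceType.
Implicit Types (A B X Y D : {fset K}) (g h : K -> {fset K}).

Lemma double_count_leq (C B : {fset K}) (R : K -> K -> bool) m n :
  (forall x, x \in C -> m <= #|` [fset y in B | R x y]|) ->
  (forall y, y \in B -> #|` [fset x in C | R x y]| <= n) ->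
  m * #|` C| <= n * #|` B|.
Proof.
move=> mC nB.
have cardE (X : {fset K}) (P : pred K) : #|` [fset y in X | P y]| = \sum_(y <- X) P y.
  rewrite card_fset_sum1 [RHS](eq_bigr (fun y => if P y then 1 else 0)); last first.
    by move=> y _; case: (P y).
  rewrite -big_mkcond -[RHS]big_filter; apply/perm_big/uniq_perm => [||y].
  - exact: fset_uniq.
  - by rewrite filter_uniq ?fset_uniq.
  - by rewrite !inE mem_filter andbC.
rewrite (_ : m * #|` C| = \sum_(x <- C) m); last first.
  by rewrite big_const_seq count_predT iter_addn_0.
rewrite (_ : n * #|` B| = \sum_(x <- B) n); last first.
  by rewrite big_const_seq count_predT iter_addn_0.
apply: (@leq_trans (\sum_(x <- C) \sum_(y <- B) R x y)).
  by rewrite big_seq [leqRHS]big_seq; apply: leq_sum => x xC; rewrite -cardE mC.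
rewrite exchange_big big_seq [leqRHS]big_seq.
by apply: leq_sum => y yB; rewrite -cardE nB.
Qed.

Definition nb g X : {fset K} := \bigcup_(x <- X) g x.

(* [far g n X] says |nabla(X)| >= n, where nabla(X) may be infinite, and
   [iso g k kap] says kap <= kappa_k. *)
Definition far g n X : Prop := exists D, n <= #|` D| /\ [disjoint D & nb g X].

Definition iso g k kap : Prop :=
  forall X, k <= #|` X| -> far g k X -> #|` X| + kap <= #|` nb g X|.

(** When [X] lies in [nb g X], as in a reflexive graph, the equation says that the boundary has size
    [kap], without a subtraction. Minimality of [kap] is left to [iso]. *)
Definition frag g k kap X : Prop :=
  [/\ k <= #|` X|, far g k X & #|` nb g X| = #|` X| + kap].

Definition fatom g k kap a A : Prop :=
  [/\ frag g k kap A, #|` A| = a & forall X, frag g k kap X -> a <= #|` X|].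

Lemma nbP {g X y} : reflect (exists2 x, x \in X & y \in g x) (y \in nb g X).
Proof.
by apply: (iffP (bigfcupP _ _ _ _)) => -[x]; rewrite ?andbT => xX yx; exists x; rewrite ?xX.
Qed.

Lemma nb1 g x : nb g [fset x] = g x.
Proof.
apply/fsetP => y; apply/nbP/idP => [[z]|xy]; first by rewrite inE => /eqP->.
by exists x; rewrite ?inE.
Qed.

Lemma nbS g X Y : X `<=` Y -> nb g X `<=` nb g Y.
Proof. by move=> /fsubsetP XY; apply/fsubsetP => y /nbP[x /XY xY xy]; apply/nbP; exists x. Qed.

Lemma sub_nb g X x : x \in X -> g x `<=` nb g X.
Proof. by move=> xX; apply/fsubsetP => y xy; apply/nbP; exists x. Qed.

Lemma nbU g X Y : nb g (X `|` Y) = nb g X `|` nb g Y.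
Proof.
apply/fsetP => y; rewrite inE; apply/nbP/orP => [[x]|[]/nbP[x xX xy]].
- by rewrite inE => /orP[xX|xX] xy; [left|right]; apply/nbP; exists x.
- by exists x; rewrite // inE xX.
- by exists x; rewrite // inE xX orbT.
Qed.

Lemma nbI g X Y : nb g (X `&` Y) `<=` nb g X `&` nb g Y.
Proof. by rewrite fsubsetI !nbS // ?fsubsetIl ?fsubsetIr. Qed.

Lemma farS g n X Y : X `<=` Y -> far g n Y -> far g n X.
Proof.
move=> XY [D [nD dD]]; exists D; split=> //.
by apply/(fdisjointWr _ dD)/nbS.
Qed.

Lemma far_leq g m n X : m <= n -> far g n X -> far g m X.
Proof. by move=> mn [D [nD dD]]; exists D; split=> //; lia. Qed.

(** The vertex set may be infinite, so the complements are compared inside the finite union of [D]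
    and [nb g X]. *)
Lemma far_card g n X Y : #|` nb g Y| <= #|` nb g X| -> far g n X -> far g n Y.
Proof.
move=> YX [D [nD dD]]; exists ((D `|` nb g X) `\` nb g Y); split; last first.
  by apply/fdisjointP => z; rewrite inE => /andP[].
have := cardfsID (nb g Y) (D `|` nb g X).
have := fsubset_leq_card (fsubsetIr (D `|` nb g X) (nb g Y)).
have := cardfsUI D (nb g X).
by rewrite (eqP dD) cardfs0; lia.
Qed.

(** Since [D] already avoids [nb g A], removing [nb g B] from it costs only points of [nb g B]
    outside [nb g A]. *)
Lemma far_union g m n A B :
  far g n A -> #|` nb g B `\` nb g A| + m <= n -> far g m (A `|` B).
Proof.
move=> [D [nD /fdisjointP dD]] mn; exists (D `\` nb g B); split; last first.
  by apply/fdisjointP => z; rewrite nbU !inE negb_or => /andP[-> /dD ->].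
have := cardfsID (nb g B) D.
have : D `&` nb g B `<=` nb g B `\` nb g A.
  by apply/fsubsetP => z; rewrite !inE => /andP[/dD -> ->].
by move=> /fsubset_leq_card; lia.
Qed.

Lemma iso_leq g j k kap : j <= k -> iso g j kap -> iso g k kap.
Proof. by move=> jk iso_g X kX fX; apply: iso_g; [lia|apply: far_leq fX]. Qed.

(** At the largest size that [D] can reach, [D] and [nb g X] together exhaust [K]; otherwise a
    missing point could be added to [D]. *)
Lemma far_finite g n X : ~ far g n X -> exists U : {fset K}, forall x, x \in U.
Proof.
elim: n => [|n IHn] nfar.
  by case: nfar; exists fset0; split=> //; rewrite fdisjoint0X.
have [[D [nD dD]]|] := pselect (far g n X); last exact: IHn.
exists (D `|` nb g X) => x; apply: contrapT => /negP.
rewrite inE negb_or => /andP[xD xX]; apply: nfar; exists (x |` D); split.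
  by rewrite cardfsU1 xD.
by rewrite fdisjointU1X xX.
Qed.

Lemma fatom_exists g k kap X : frag g k kap X -> exists a A, fatom g k kap a A.
Proof.
move=> fX; have : exists n, `[< exists2 Y, frag g k kap Y & #|` Y| = n >].
  by exists #|` X|; apply/asboolP; exists X.
move=> /ex_minnP[a /asboolP[A fA cA] amin]; exists a, A; split=> // Y fY.
by apply: amin; apply/asboolP; exists Y.
Qed.

Lemma fatom_small g k kap a A X : iso g k kap -> fatom g k kap a A ->
  k <= #|` X| < a -> far g k X -> #|` X| + kap < #|` nb g X|.
Proof.
move=> iso_g [_ _ amin] /andP[kX Xa] fX.
rewrite ltn_neqAle iso_g // andbT; apply/negP => /eqP eX.
suff: a <= #|` X| by lia.
by apply: amin; split.
Qed.

(** Submodularity: if the intersection is smaller than an atom, its boundary exceeds [kap], so the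
    boundary of the union falls below [kap]. This contradicts [iso], which applies because
    [far g a A] leaves [k] points outside the neighbourhood of the union. *)
Lemma fatom_inter g k kap a A B : iso g k kap ->
  fatom g k kap a A -> fatom g k kap a B -> far g a A ->
  k <= #|` A `&` B| -> A = B.
Proof.
move=> iso_g aA aB farA kI.
have [[kA fA nA] cA _] := aA; have [[kB fB nB] cB _] := aB.
have := fsubset_leq_card (fsubsetIl A B); rewrite cA leq_eqVlt => /orP[/eqP eI|ltI].
  apply/eqP; rewrite eqEfcard cA cB leqnn andbT.
  by apply/fsetIidPl/eqP; rewrite eqEfcard fsubsetIl cA eI /=.
have := fatom_small (X := A `&` B) iso_g aA.
rewrite kI ltI => /(_ isT (farS (fsubsetIl _ _) fA)) gI.
have := fsubset_leq_card (nbI g A B).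
have := cardfsUI (nb g A) (nb g B); have := cardfsUI A B.
have := cardfsID (nb g A) (nb g B); rewrite (fsetIC (nb g B)) => ? ? ? ?.
have : #|` A `|` B| + kap <= #|` nb g (A `|` B)|.
  apply: iso_g; first lia.
  by apply: (far_union farA); lia.
rewrite nbU; lia.
Qed.

(* [iso g 1 kap] bounds the boundary of [F `&` G] from below, so that [F `|` G] is
   again a fragment; maximality of [F] concludes. *)
Lemma superfrag_inter g kap F G : iso g 1 kap ->
  frag g 2 kap F -> frag g 2 kap G -> #|` G| = #|` F| ->
  (forall X, frag g 2 kap X -> #|` X| <= #|` F|) ->
  far g #|` F|.+1 F -> 0 < #|` F `&` G| -> F = G.
Proof.
move=> iso_g [kF fF nF] [kG fG nG] cG Fmax farF I0.
have gI : #|` F `&` G| + kap <= #|` nb g (F `&` G)|.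
  by apply: iso_g => //; apply: (farS (fsubsetIl _ _)); apply: far_leq fF.
have := fsubset_leq_card (nbI g F G).
have := cardfsUI (nb g F) (nb g G); have := cardfsUI F G.
have := cardfsID (nb g F) (nb g G); rewrite (fsetIC (nb g G)) => ? ? ? ?.
have := fsubset_leq_card (fsubsetIr F G) => ?.
(* At most |F| - 1 points of [nb g G] lie outside [nb g F], so |F| + 1 far points of [F] leave the
   two that are required. *)
have farU : far g 2 (F `|` G) by apply: (far_union farF); lia.
have isoU : #|` F `|` G| + kap <= #|` nb g (F `|` G)|.
  by apply: iso_g; [lia|apply: far_leq farU].
have : frag g 2 kap (F `|` G) by split=> //; [lia|rewrite nbU in isoU *; lia].
move=> /Fmax cU; apply/eqP; rewrite eq_sym eqEfcard cG leqnn andbT.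
have -> : F = F `|` G; last exact: fsubsetUr.
by apply/eqP; rewrite eqEfcard fsubsetUl.
Qed.

(** * Complements of neighbourhoods as fragments of the reverse graph *)

Section Reverse.
Variables g h : K -> {fset K}.
Hypothesis adj : forall x y, (y \in g x) = (x \in h y).

Lemma disjoint_nb D X : [disjoint D & nb g X] = [disjoint X & nb h D].
Proof.
apply/fdisjointP/fdisjointP => dD x xX; apply/nbP => -[y yD].
  by rewrite -adj => xy; move/nbP: (dD _ yD); case; exists x.
by rewrite adj => xy; move/nbP: (dD _ yD); case; exists x.
Qed.

Variable U : {fset K}.
Hypothesis fullU : forall x, x \in U.

Lemma sub_fullU X : X `<=` U. Proof. by apply/fsubsetP. Qed.

Lemma card_compl X : #|` U `\` X| = #|` U| - #|` X|.
Proof. exact: cardfsDS (sub_fullU _). Qed.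

Lemma leq_fullU X : #|` X| <= #|` U|.
Proof. exact: fsubset_leq_card (sub_fullU _). Qed.

Lemma far_compl n X : far g n X <-> n <= #|` U `\` nb g X|.
Proof.
split=> [[D [nD dD]]|nX].
  apply: leq_trans nD (fsubset_leq_card _).
  by apply/fsubsetP => z zD; rewrite inE fullU andbT; move/fdisjointP: dD; apply.
exists (U `\` nb g X); split=> //.
by apply/fdisjointP => z; rewrite inE => /andP[].
Qed.

Lemma compl_far n X : n <= #|` X| -> far h n (U `\` nb g X).
Proof.
move=> nX; exists X; split=> //; rewrite -disjoint_nb.
by apply/fdisjointP => z; rewrite inE => /andP[].
Qed.

Lemma nb_compl X : #|` nb h (U `\` nb g X)| + #|` X| <= #|` U|.
Proof.
have dX : [disjoint X & nb h (U `\` nb g X)].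
  by rewrite -disjoint_nb; apply/fdisjointP => z; rewrite inE => /andP[].
have := cardfsUI X (nb h (U `\` nb g X)).
rewrite (eqP dX) cardfs0.
have := leq_fullU (X `|` nb h (U `\` nb g X)); lia.
Qed.

(** The complement of [nb g X] has [X] far from it in the reverse graph, and by [nb_compl] its
    boundary there is no larger than that of [X]. When both constants agree this is an equality,
    which gives [frag_compl]. *)
Lemma iso_reverse_leq k kap kap' X :
  iso h k kap' -> frag g k kap X -> kap' <= kap.
Proof.
move=> iso_h [kX fX nX]; have := iso_h _ (proj1 (far_compl _ _) fX) (compl_far kX).
have := nb_compl X; rewrite card_compl nX.
have := leq_fullU (nb g X); lia.
Qed.

Lemma frag_compl k kap X :
  iso h k kap -> frag g k kap X -> frag h k kap (U `\` nb g X).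
Proof.
move=> iso_h [kX fX nX].
have isoX := iso_h _ (proj1 (far_compl _ _) fX) (compl_far kX).
split; [exact/far_compl|exact: compl_far|].
apply/eqP; rewrite eqn_leq isoX andbT.
have := nb_compl X; rewrite card_compl nX; have := leq_fullU (nb g X); lia.
Qed.

(** The arcs of a finite graph are counted once by their tails and once by their heads. *)
Lemma degree_count d d' : (forall x, #|` g x| = d) -> (forall x, #|` h x| = d') ->
  0 < #|` U| -> d = d'.
Proof.
move=> gd hd U0.
have gE x : [fset y in U | y \in g x] = g x.
  by apply/fsetP => y; rewrite !inE fullU.
have hE y : [fset x in U | y \in g x] = h y.
  by apply/fsetP => x; rewrite !inE fullU adj.
apply/eqP; rewrite eqn_leq; apply/andP; split; rewrite -(leq_pmul2r U0).
  apply: (double_count_leq (R := fun x y => y \in g x)) => x _.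
    by rewrite gE gd.
  by rewrite hE hd.
apply: (double_count_leq (R := fun y x => y \in g x)) => x _.
  by rewrite hE hd.
by rewrite gE gd.
Qed.

End Reverse.

(** * Intersecting 2-atoms when the degree is [kap.+1] *)

Section TwoAtoms.
Variables (g : K -> {fset K}) (kap a : nat).
Hypotheses (deg : forall x, #|` g x| = kap.+1) (iso1 : iso g 1 kap).
Variables A B : {fset K}.
Hypotheses (aA : fatom g 2 kap a A) (aB : fatom g 2 kap a B).
Hypotheses (farA : far g a A) (neAB : A <> B).

Lemma atom2_inter : #|` A `&` B| <= 1.
Proof.
rewrite leqNgt; apply/negP => I2; apply: neAB.
by apply: fatom_inter aA aB farA I2; apply: iso_leq iso1.
Qed.

(** The union has 2a - 1 points, so [iso] gives its neighbourhood at least 2a - 1 + kap points. As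
    the two neighbourhoods have 2a + 2kap points in total, they share at most kap + 1, which is the
    size of [g y]. *)
Lemma atom2_nb_inter y : y \in A -> y \in B -> nb g A `&` nb g B = g y.
Proof.
move=> yA yB; have := atom2_inter; have [[kA fA nA] cA _] := aA.
have [[kB _ nB] cB _] := aB.
have sub : g y `<=` nb g A `&` nb g B by rewrite fsubsetI !sub_nb.
have := fsubset_leq_card sub; rewrite deg.
have := cardfsUI (nb g A) (nb g B); have := cardfsUI A B.
have := cardfsID (nb g A) (nb g B); rewrite (fsetIC (nb g B)) => ? ? ? ? ?.
have : #|` A `|` B| + kap <= #|` nb g (A `|` B)|.
  apply: iso1; first lia.
  by apply: (far_union farA); lia.
rewrite nbU => ?; apply/esym/eqP; rewrite eqEfcard sub deg /=; lia.
Qed.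

End TwoAtoms.

(** * Crossing 2-atoms of the graph and of its reverse *)

Section TwoGraphs.
Variables (g h : K -> {fset K}) (kap kap' a b : nat).
Hypothesis adj : forall x y, (y \in g x) = (x \in h y).
Hypotheses (gdeg : forall x, #|` g x| = kap.+1) (hdeg : forall x, #|` h x| = kap'.+1).
Hypotheses (giso : iso g 1 kap) (hiso : iso h 1 kap').
Hypotheses (gfar : forall A, fatom g 2 kap a A -> far g a A)
  (hfar : forall B, fatom h 2 kap' b B -> far h b B).
Hypotheses (leab : a <= b) (a_gt2 : 2 < a).

Let gline := fatom g 2 kap a.
Let hline := fatom h 2 kap' b.

Section Cross.
Variables A B : {fset K}.
Hypotheses (lA : gline A) (lB : hline B).

(** The two differences are dual under reversal: [nb h W] avoids [A] and [nb g X] avoids [B], so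
    each of |W| and |X| controls the neighbourhood of the other. *)
Let W := B `\` nb g A.
Let X := A `\` nb h B.

Lemma cross_inner : nb h W `<=` nb h B `\` A.
Proof.
apply/fsubsetP => z zW; rewrite inE (fsubsetP (nbS h (fsubsetDl B (nb g A)))) // andbT.
have : [disjoint A & nb h W].
  by rewrite -(disjoint_nb adj); apply/fdisjointP => t; rewrite inE => /andP[].
by rewrite fdisjoint_sym => /fdisjointP; apply.
Qed.

Lemma cross_counts :
  [/\ b + #|` nb g X| <= #|` W| + (a + kap),
      #|` nb h B `\` A| + a = b + kap' + #|` X|,
      #|` nb h W| + a <= b + kap' + #|` X|,
      0 < #|` W| -> #|` W| + kap' <= #|` nb h W| &
      1 < #|` W| < b -> #|` W| + kap' < #|` nb h W| ].
Proof.
have [[kA fA nA] cA _] := lA; have [[kB fB nB] cB _] := lB.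
have TA : #|` nb h B `\` A| + a = b + kap' + #|` X|.
  have := cardfsID A (nb h B); have := cardfsID (nb h B) A.
  by rewrite -/X (fsetIC A) nB cA cB; lia.
have farW : far h 2 W by apply: farS fB; apply: fsubsetDl.
split=> //.
- have := cardfsID (nb g A) B; have := cardfsID B (nb g A).
  rewrite -/W (fsetIC B) nA cA cB.
  have : nb g X `<=` nb g A `\` B.
    apply/fsubsetP => z zX; rewrite inE (fsubsetP (nbS g (fsubsetDl A (nb h B)))) // andbT.
    have : [disjoint B & nb g X].
      by rewrite (disjoint_nb adj); apply/fdisjointP => t; rewrite inE => /andP[].
    by rewrite fdisjoint_sym => /fdisjointP; apply.
  by move=> /fsubset_leq_card; lia.
- by have := fsubset_leq_card cross_inner; lia.
- by move=> W0; apply: hiso => //; apply: far_leq farW.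
- by move=> W1; apply: (fatom_small _ lB) => //; apply: iso_leq hiso.
Qed.

(** If |X| > 1, then [X] is smaller than a 2-atom and its boundary exceeds [kap], so the first count
    yields |W| > b - a + |X|. The third and fourth counts yield the opposite inequality; [leab]
    makes [W] nonempty. *)
Lemma cross : ~~ [disjoint A & nb h B]%fset -> #|` X| <= 1.
Proof.
move=> meet; rewrite leqNgt; apply/negP => X1.
have [[kA fA nA] cA _] := lA; have [c1 _ c2 c3 _] := cross_counts.
have Xa : #|` X| < a.
  rewrite -cA; apply: fproper_ltn_card; rewrite fproperE fsubsetDl /=.
  by apply: contra meet => /fsubsetP sX; apply/fdisjointP => z /sX; rewrite inE => /andP[].
have : #|` X| + kap < #|` nb g X|.
  apply: (fatom_small _ lA); rewrite ?X1 //; first exact: iso_leq giso.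
  by apply: farS fA; apply: fsubsetDl.
lia.
Qed.

(** The first count gives |W| > b - a. If |W| > 1, the strict inequality for sets smaller than a
    2-atom gives |W| <= b - a, so |W| = 1 and a = b. The single point of [W] is [y], and both sides
    of the last equation have kap' + 1 elements. *)
Lemma cross_tangent : #|` X| = 1 -> a = b /\ exists2 y, y \in B & h y = nb h B `\` A.
Proof.
move=> X1; have [c1 c0 c2 c3 c4] := cross_counts.
have /eqP/cardfs1P[x eX] := X1.
move: c1; rewrite [in nb g X]eX nb1 gdeg => c1.
have W1 : #|` W| = 1 by lia.
split; first by lia.
have /eqP/cardfs1P[y eW] := W1; exists y.
  have : y \in W by rewrite eW inE.
  by rewrite inE => /andP[].
apply/eqP; rewrite -nb1 -eW eqEfcard cross_inner /= eW nb1 hdeg; lia.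
Qed.

End Cross.

(** * Contradiction from several 2-atoms through each vertex *)

Hypothesis two_hlines : forall y B, exists B', [/\ hline B', y \in B' & B' <> B].
Hypothesis three_glines : forall x A, exists L1 L2,
  [/\ gline L1, gline L2, x \in L1 & x \in L2] /\ [/\ L1 <> L2, L1 <> A & L2 <> A].

Lemma hline_nb_inter B1 B2 y : hline B1 -> hline B2 -> B1 <> B2 ->
  y \in B1 -> y \in B2 -> nb h B1 `&` nb h B2 = h y.
Proof. by move=> l1 l2 ne; apply: (atom2_nb_inter hdeg hiso l1 l2) => //; apply: hfar. Qed.

Lemma meet_nb A B x y : x \in A -> x \in h y -> y \in B -> ~~ [disjoint A & nb h B]%fset.
Proof.
move=> xA xy yB; apply/negP => /fdisjointP/(_ _ xA)/negP; apply.
by apply/nbP; exists y.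
Qed.

(** Without tangents, a 2-atom [A] through [x0] lies in both [nb h B1] and [nb h B2] for two 2-atoms
    through any [y] in [nb g A], hence in [h y]. So [nb g A] would be contained in [g x0], which is
    too small. *)
Lemma tangent_exists (x0 : K) :
  exists A B, [/\ gline A, hline B & #|` A `\` nb h B| = 1].
Proof.
apply: contrapT => notan.
have inT A B x y : gline A -> hline B -> x \in A -> x \in h y -> y \in B -> A `<=` nb h B.
  move=> lA lB xA xy yB; rewrite -fsetD_eq0 -cardfs_eq0.
  have := cross lA lB (meet_nb xA xy yB).
  case E : #|` _| => [|[|n]] // _; case: notan; exists A, B; split=> //.
have [A [_ [[lA _ xA _] _]]] := three_glines x0 fset0.
have sub : nb g A `<=` g x0.
  apply/fsubsetP => y /nbP[x' x'A]; rewrite adj => x'y.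
  have [B1 [l1 y1 _]] := two_hlines y fset0.
  have [B2 [l2 y2 ne]] := two_hlines y B1.
  rewrite adj -(hline_nb_inter l2 l1 ne y2 y1) inE.
  by rewrite !(fsubsetP (inT _ _ _ _ lA _ x'A x'y _) _ xA).
have [[_ _ nA] cA _] := lA.
by have := fsubset_leq_card sub; rewrite gdeg nA; lia.
Qed.

Lemma gline_inter L L' : gline L -> gline L' -> 1 < #|` L `&` L'| -> L = L'.
Proof.
move=> lL lL' I1; apply: contrapT => ne.
by have := atom2_inter giso lL lL' (gfar lL) ne; rewrite leqNgt I1.
Qed.

Lemma too_many_lines (x0 : K) : False.
Proof.
have [A [B1 [lA l1 tan]]] := tangent_exists x0.
have [eab [y y1 hy]] := cross_tangent lA l1 tan.
have [B2 [l2 y2 ne]] := two_hlines y B1.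
have TT := hline_nb_inter l2 l1 ne y2 y1.
pose tangent x L z := [/\ gline L, L `\` nb h B2 = [fset x] & h z = nb h B2 `\` L].
pose R x z := `[< exists L, tangent x L z >].
have lineT x L z : tangent x L z -> L `&` nb h B2 = nb h B2 `\` h z.
  by move=> [_ _ ->]; apply/fsetP => t; rewrite !inE; case: (t \in L); case: (_ \in _).
(* The vertex [z] determines the trace of [L] on [nb h B2], which has a - 1 >= 2 points and so
   determines [L]. *)
have uniqL x x' L L' z : tangent x L z -> tangent x' L' z -> L = L'.
  move=> tx tx'; have [lL eL _] := tx; have [lL' _ _] := tx'.
  have [_ cL _] := lL.
  apply: gline_inter => //; apply: (@leq_trans #|` L `&` nb h B2|).
    by have := cardfsID (nb h B2) L; rewrite eL cardfs1; lia.
  apply: fsubset_leq_card; rewrite fsubsetI fsubsetIl (lineT _ _ _ tx).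
  by rewrite -(lineT _ _ _ tx') fsubsetIl.
have tanL x L : x \in A `&` nb h B1 -> gline L -> x \in L -> L <> A ->
    exists2 z, z \in B2 & tangent x L z.
  rewrite inE => /andP[xA xT1] lL xL neL.
  (* The two neighbourhoods meet in [h y], which is disjoint from [A]. *)
  have xT2 : x \notin nb h B2.
    apply/negP => xT2; have : x \in nb h B2 `&` nb h B1 by rewrite inE xT2.
    by rewrite TT hy inE xA.
  have [_ cL _] := lL.
  have /nbP[y' y'B1 xy'] := xT1.
  have c1 := cross lL l1 (meet_nb xL xy' y'B1).
  (* At most one point of [L] is outside [nb h B1], so a second point [u] of [L] is inside. It is
     not in [A], hence lies in [h y], and through it [L] meets [nb h B2]. *)
  have [u] : exists u, u \in (L `&` nb h B1) `\ x.
    apply/fset0Pn; rewrite -cardfs_gt0.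
    have := cardfsD1 x (L `&` nb h B1); have := cardfsID (nb h B1) L.
    have -> : x \in L `&` nb h B1 by rewrite inE xL.
    by rewrite cL; lia.
  rewrite !inE => /and3P[ux uL uT1].
  have uA : u \notin A.
    apply/negP => uA; apply: neL; apply: gline_inter => //.
    apply: (@leq_trans #|` [fset u; x]|); first by rewrite cardfs2 ux.
    by apply/fsubset_leq_card/fsubsetP => v; rewrite !inE => /orP[]/eqP->; apply/andP.
  have uy : u \in h y by rewrite hy inE uA.
  have c2 := cross lL l2 (meet_nb uL uy y2).
  have eL : L `\` nb h B2 = [fset x].
    apply/eqP; rewrite eq_sym eqEfcard cardfs1 c2 andbT.
    by apply/fsubsetP => v; rewrite !inE => /eqP->; rewrite xT2.
  have c3 : #|` L `\` nb h B2| = 1 by rewrite eL cardfs1.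
  have [_ [z zB2 hz]] := cross_tangent lL l2 c3.
  by exists z.
(* Each [x] has two lines besides [A], hence two values of [z]; each [z] fixes [L] and thereby the
   only point of [L] outside [nb h B2]. *)
have := double_count_leq (C := A `&` nb h B1) (B := B2) (R := R) (m := 2) (n := 1).
have [_ cA _] := lA; have [_ c2 _] := l2.
have := cardfsID (nb h B1) A => cC H; suff: 2 * #|` A `&` nb h B1| <= 1 * #|` B2| by lia.
apply: H => [x xC|z zB2].
  have [L1 [L2 [[lL1 lL2 xL1 xL2] [ne12 ne1 ne2]]]] := three_glines x A.
  have [z1 z1B t1] := tanL _ _ xC lL1 xL1 ne1.
  have [z2 z2B t2] := tanL _ _ xC lL2 xL2 ne2.
  have nez : z1 != z2.
    by apply/eqP => ez; apply: ne12; rewrite -ez in t2; apply: uniqL t1 t2.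
  apply: (@leq_trans #|` [fset z1; z2]|); first by rewrite cardfs2 nez.
  apply/fsubset_leq_card/fsubsetP => v; rewrite !inE => /orP[]/eqP->.
    by rewrite z1B; apply/asboolP; exists L1.
  by rewrite z2B; apply/asboolP; exists L2.
have [->|[x xS]] := fset_0Vmem [fset x in A `&` nb h B1 | R x z]; first by rewrite cardfs0.
rewrite -(cardfs1 x); apply/fsubset_leq_card/fsubsetP => x'.
move: xS; rewrite !inE => /andP[_ /asboolP[L tL]] /andP[_ /asboolP[L' tL']].
have eL := uniqL _ _ _ _ _ tL tL'.
have [_ e1 _] := tL; have [_ e2 _] := tL'.
have : x' \in L `\` nb h B2 by rewrite eL e2 inE.
by rewrite e1 inE.
Qed.

End TwoGraphs.
End FsetNeighbourhoods.

(** * Automorphisms, blocks and the theorem *)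

Section Transport.
Variables (K : choiceType) (g : K -> {fset K}) (f : K -> K).
Hypotheses (f_inj : injective f) (f_aut : forall x, g (f x) = f @` g x).
Implicit Types X : {fset K}.

Lemma card_aut X : #|` f @` X| = #|` X|.
Proof. exact: card_imfset. Qed.

Lemma nb_aut X : nb g (f @` X) = f @` nb g X.
Proof.
apply/fsetP => y; apply/nbP/imfsetP => [[_ /imfsetP[x xX ->]]|[z /nbP[x xX xz] ->]].
  by rewrite f_aut => /imfsetP[z xz ->]; exists z => //; apply/nbP; exists x.
by exists (f x); rewrite ?f_aut; apply: in_imfset.
Qed.

Lemma far_aut n X : far g n X -> far g n (f @` X).
Proof.
move=> [D [nD /fdisjointP dD]]; exists (f @` D); rewrite card_aut nb_aut; split=> //.
apply/fdisjointP => _ /imfsetP[x /dD xX ->]; apply: contra xX.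
by move=> /imfsetP[z zX /f_inj->].
Qed.

Lemma frag_aut k kap X : frag g k kap X -> frag g k kap (f @` X).
Proof. by move=> [kX fX nX]; split; rewrite ?nb_aut ?card_aut //; apply: far_aut. Qed.

Lemma fatom_aut k kap a X : fatom g k kap a X -> fatom g k kap a (f @` X).
Proof. by move=> [fX cX Xmin]; split; rewrite ?card_aut //; apply: frag_aut. Qed.

End Transport.

(** * Predicates and lists versus finite sets *)

Section FiniteSets.
Variable V : Type.
Local Notation K := {classic V}.
Implicit Types X F : {fset K}.

(** [V] is an arbitrary type; [{classic V}] supplies by classical axioms the choice structure that
    finite sets require. *)
Definition pset F : vset V := fun x => (x : K) \in F.

Lemma pset_inj X F : set_eq V (pset X) (pset F) <-> X = F.
Proof. by split=> [XF|->//]; apply/fsetP => x; apply/idP/idP => /XF. Qed.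

Lemma InE (x : K) (l : seq K) : List.In x l <-> x \in l.
Proof.
elim: l => //= y l IHl; rewrite inE; split=> [[-> | /IHl -> ]|/orP[/eqP -> | /IHl]].
- by rewrite eqxx.
- by rewrite orbT.
- by left.
- by right.
Qed.

Lemma NoDupE (l : seq K) : List.NoDup l <-> uniq l.
Proof.
elim: l => [|x l IHl] /=; first by split=> // _; constructor.
split=> [nd|/andP[/negP xl /IHl ul]]; last by constructor=> // /InE.
inversion_clear nd as [|? ? xl ul]; rewrite (proj1 IHl ul) andbT.
by apply/negP => /InE.
Qed.

Lemma card_pset F n : card V (pset F) n <-> #|` F| = n.
Proof.
split=> [[l [/NoDupE ul [<- lF]]]|<-].
  rewrite (_ : F = [fset x in (l : seq K)]); first by rewrite card_fseq undup_id.
  by apply/fsetP => x; rewrite inE /=; apply/idP/idP => [/lF/InE|/InE/lF].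
exists (enum_fset F); split; first exact/NoDupE/fset_uniq.
by split=> // x; split=> [xF|/InE//]; apply/InE.
Qed.

Lemma card_fset_of (S : vset V) n : card V S n -> exists2 F, S = pset F & #|` F| = n.
Proof.
move=> cS; have [l [ul [_ lS]]] := cS.
have eS : S = pset [fset x in (l : seq K)].
  apply: funext => x; apply: propext; rewrite lS /pset inE /=; exact: (InE x l).
by exists [fset x in (l : seq K)] => //; apply/card_pset; rewrite -eS.
Qed.

Lemma atleastE (S : vset V) n :
  atleast V n S <-> exists2 F : {fset K}, n <= #|` F| & forall x : K, x \in F -> S x.
Proof.
split=> [[l [/NoDupE ul [<- lS]]]|[F nF FS]].
  exists [fset x in (l : seq K)]; first by rewrite card_fseq undup_id.
  by move=> x; rewrite inE /= => /InE/lS.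
exists (take n (enum_fset F)); split; first exact/NoDupE/take_uniq/fset_uniq.
by split=> [|x /InE/mem_take/FS//]; apply: size_takel.
Qed.

End FiniteSets.

(** * Fragments, atoms and blocks of a graph in terms of finite sets *)

Section GraphInterface.
Variables (V : Type) (E : V -> V -> Prop).
Local Notation K := {classic V}.
Variable g : K -> {fset K}.
Hypotheses (gE : forall x y, y \in g x <-> E x y) (E_refl : reflexive_graph V E).
Implicit Types X F A : {fset K}.

Lemma nbrsE F y : nbrs V E (pset F) y <-> y \in nb g F.
Proof.
split=> [[x [xF /gE xy]]|/nbP[x xF /gE xy]]; last by exists x.
by apply/nbP; exists x.
Qed.

Lemma sub_nb_refl F : F `<=` nb g F.
Proof. by apply/fsubsetP => x xF; apply/nbP; exists x => //; apply/gE/E_refl. Qed.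

Lemma atleast_ext F n : atleast V n (ext V E (pset F)) <-> far g n F.
Proof.
rewrite atleastE; split=> [[D nD dD]|[D [nD /fdisjointP dD]]]; exists D => //.
  by split=> //; apply/fdisjointP => x /dD xF; apply/negP => /nbrsE.
by move=> x /dD/negP xF /nbrsE.
Qed.

Lemma card_bdry F n : card V (bdry V E (pset F)) n <-> #|` nb g F| = #|` F| + n.
Proof.
have -> : bdry V E (pset F) = pset (nb g F `\` F).
  apply: funext => y; apply: propext; rewrite /bdry nbrsE /pset inE.
  by split=> [[-> /negP->]|/andP[/negP ? ->]].
rewrite card_pset (cardfsDS (sub_nb_refl F)).
by have := fsubset_leq_card (sub_nb_refl F); lia.
Qed.

Lemma admissibleE k F : admissible V E k (pset F) <-> k <= #|` F| /\ far g k F.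
Proof.
rewrite /admissible atleast_ext atleastE; split=> [[_ [[D kD DF] fF]]|[kF fF]].
  by split=> //; apply: leq_trans kD (fsubset_leq_card _); apply/fsubsetP.
by split; [exists #|` F|; apply/card_pset|split=> //; exists F].
Qed.

Lemma admissible_fset k (S : vset V) : admissible V E k S -> exists F, S = pset F.
Proof. by move=> [[n /card_fset_of[F -> _]] _]; exists F. Qed.

Lemma is_kappaE k n : is_kappa V E k n <-> iso g k n /\ exists F, frag g k n F.
Proof.
split=> [[[S [aS bS]] nmin]|[iso_g [F [kF fF nF]]]].
  split; last first.
    have [F eS] := admissible_fset aS; exists F.
    by move: aS bS; rewrite eS => /admissibleE[? ?] /card_bdry.
  move=> F kF fF; have FnF := fsubset_leq_card (sub_nb_refl F).
  suff : n <= #|` nb g F| - #|` F| by lia.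
  by apply/leP/(nmin (pset F)); [apply/admissibleE|apply/card_bdry; lia].
split; first by exists (pset F); split; [apply/admissibleE|apply/card_bdry].
move=> S m aS; have [X eS] := admissible_fset aS; move: aS; rewrite eS.
by move=> /admissibleE[kX /iso_g-/(_ kX) isoX] /card_bdry eX; apply/leP; lia.
Qed.

Section Kappa.
Variables (k n : nat).
Hypothesis kappa_n : is_kappa V E k n.

Lemma fragmentE F : fragment V E k (pset F) <-> frag g k n F.
Proof.
rewrite /fragment; split=> [[/admissibleE[kF fF] [m [km /card_bdry nF]]]|[kF fF nF]].
  suff -> : n = m by [].
  have [[X1 [a1 b1]] min1] := km; have [[X2 [a2 b2]] min2] := kappa_n.
  by have := min1 _ _ a2 b2; have := min2 _ _ a1 b1; lia.
by split; [apply/admissibleE|exists n; split=> //; apply/card_bdry].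
Qed.

Lemma atomE A : atom V E k (pset A) <-> fatom g k n #|` A| A.
Proof.
split=> [[/fragmentE fA [a [/card_pset cA amin]]]|[/fragmentE fA _ Amin]].
  split=> // X /fragmentE fX; rewrite cA; apply/leP/(amin (pset X)) => //.
  exact/card_pset.
split=> //; exists #|` A|; split; first exact/card_pset.
move=> S b fS; have [X eS] := admissible_fset (proj1 fS).
by move: fS; rewrite eS => /fragmentE/Amin Ab /card_pset <-; apply/leP.
Qed.

Lemma fatom_atom a A : fatom g k n a A -> atom V E k (pset A).
Proof. by move=> aA; apply/atomE; have [_ -> _] := aA. Qed.

Lemma fatom_exists_kappa : exists a A, fatom g k n a A.
Proof. by have /is_kappaE[_ [X /fatom_exists]] := kappa_n. Qed.

(** All atoms have the same size and equally large neighbourhoods, so faithfulness of one passes to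
    every other by [far_card]. *)
Lemma faithful_fatom a A : faithful V E k -> fatom g k n a A -> far g a A.
Proof.
move=> [S [aS fS]] aA; have [X eS] := admissible_fset (proj1 (proj1 aS)).
move: aS fS; rewrite eS => /atomE[fX _ Xmin] cX.
have [fA cA Amin] := aA; have aX : #|` X| = a.
  by apply/eqP; rewrite eqn_leq Amin // -cA Xmin.
have {cX}/atleast_ext : atleast V a (ext V E (pset X)) by apply: cX; apply/card_pset.
apply: far_card; have [_ _ ->] := fX; have [_ _ ->] := fA.
by rewrite cA aX.
Qed.

Lemma not_faithful a A : ~ faithful V E k -> fatom g k n a A -> ~ far g a A.
Proof.
move=> nf aA fA; apply: nf; exists (pset A); split; first exact: fatom_atom aA.
have [_ cA _] := aA; move=> m /card_pset; rewrite cA => <-.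
exact/atleast_ext.
Qed.

End Kappa.

Lemma aut_inj f : automorphism V E f -> injective (f : K -> K).
Proof. by move=> [[f' [fK _]] _]; apply: can_inj fK. Qed.

Lemma aut_nb f (x : K) : automorphism V E f -> g (f x) = (f : K -> K) @` g x.
Proof.
move=> [_ fE]; apply/fsetP => y; apply/idP/imfsetP => [/gE|[z /gE xz ->]].
  by move=> /(fE x)[z [/gE xz <-]]; exists z.
by apply/gE/(fE x); exists z.
Qed.

Lemma block_pset F :
  (forall f, automorphism V E f -> 0 < #|` F `&` (f : K -> K) @` F| ->
    F = (f : K -> K) @` F) ->
  block V E (pset F).
Proof.
move=> Fblock f fA; have eF : image V f (pset F) = pset ((f : K -> K) @` F).
  apply: funext => y; apply: propext; split=> [[x [xF <-]]|/imfsetP[x xF ->]].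
    exact: in_imfset.
  by exists x.
rewrite eF; have [I0|I0] := posnP #|` F `&` (f : K -> K) @` F|; last first.
  by left; apply/pset_inj; rewrite -Fblock.
right=> y [fy yF]; have : (y : K) \in F `&` (f : K -> K) @` F by apply/fsetIP.
by rewrite (cardfs0_eq I0).
Qed.

Lemma fatom1_block n a A : is_kappa V E 1 n -> fatom g 1 n a A -> far g a A ->
  block V E (pset A).
Proof.
move=> /is_kappaE[iso_g _] aA fA; apply: block_pset => f f_aut.
apply: (fatom_inter _ aA _ fA) => //.
by apply: fatom_aut aA; [exact: aut_inj|move=> x; apply: aut_nb].
Qed.

Hypothesis E_trans : vertex_transitive V E.

Lemma degree_const (x y : K) : #|` g x| = #|` g y|.
Proof.
have [f [f_aut <-]] := E_trans x y.
by rewrite (aut_nb _ f_aut) card_aut //; apply: aut_inj.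
Qed.

(** An automorphism carries the three atoms to [y], and at most one of the images equals [A]. *)
Lemma fatoms_transport n a (x : K) F1 F2 F3 :
  fatom g 2 n a F1 -> fatom g 2 n a F2 -> fatom g 2 n a F3 ->
  F1 <> F2 -> F1 <> F3 -> F2 <> F3 -> x \in F1 -> x \in F2 -> x \in F3 ->
  forall (y : K) A, exists L1 L2,
    [/\ fatom g 2 n a L1, fatom g 2 n a L2, y \in L1 & y \in L2] /\
    [/\ L1 <> L2, L1 <> A & L2 <> A].
Proof.
move=> a1 a2 a3 n12 n13 n23 x1 x2 x3 y A.
have [f [f_aut <-]] := E_trans x y; have f_inj := aut_inj f_aut.
pose i F := (f : K -> K) @` F; have i_inj F F' : F <> F' -> i F <> i F'.
  move=> ne; apply: contra_not ne => /fsetP eF; apply/fsetP => z.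
  by have := eF (f z); rewrite !mem_imfset.
have ia F : fatom g 2 n a F -> fatom g 2 n a (i F).
  by apply: fatom_aut => // z; apply: aut_nb.
have fx F : x \in F -> f x \in i F by move=> xF; apply: in_imfset.
have [e1|ne1] := pselect (i F1 = A).
  exists (i F2), (i F3); split; first by split; auto.
  by rewrite -e1; split; apply: i_inj; auto.
have [e2|ne2] := pselect (i F2 = A).
  exists (i F1), (i F3); split; first by split; auto.
  by rewrite -e2; split; apply: i_inj; auto.
exists (i F1), (i F2); split; first by split; auto.
by split=> //; apply: i_inj.
Qed.

Lemma atoms_transport n a (x : K) A (A1 A2 A3 : vset V) : is_kappa V E 2 n -> fatom g 2 n a A ->
  atom V E 2 A1 -> atom V E 2 A2 -> atom V E 2 A3 ->
  ~ set_eq V A1 A2 -> ~ set_eq V A1 A3 -> ~ set_eq V A2 A3 ->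
  A1 x -> A2 x -> A3 x ->
  forall (y : K) A, exists L1 L2,
    [/\ fatom g 2 n a L1, fatom g 2 n a L2, y \in L1 & y \in L2] /\
    [/\ L1 <> L2, L1 <> A & L2 <> A].
Proof.
move=> kn aA aA1 aA2 aA3.
have [F1 e1] := admissible_fset (proj1 (proj1 aA1)).
have [F2 e2] := admissible_fset (proj1 (proj1 aA2)).
have [F3 e3] := admissible_fset (proj1 (proj1 aA3)).
move: aA1 aA2 aA3; rewrite e1 e2 e3.
have size_a F : atom V E 2 (pset F) -> fatom g 2 n a F.
  move=> /(atomE kn) aF; have [fF _ Fmin] := aF; have [fA cA Amin] := aA.
  suff <- : #|` F| = a by [].
  by apply/eqP; rewrite eqn_leq Amin // -cA Fmin.
move=> /size_a aF1 /size_a aF2 /size_a aF3.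
rewrite !pset_inj; exact: fatoms_transport.
Qed.

Lemma atom_card_neq2 n : is_kappa V E 2 n -> ~ (forall S, atom V E 2 S -> card V S 2) ->
  exists a A, fatom g 2 n a A /\ 2 < a.
Proof.
move=> kn /existsNP[S /not_implyP[aS cS]].
have [A eS] := admissible_fset (proj1 (proj1 aS)).
move: aS cS; rewrite eS card_pset => /(atomE kn) aA cA.
exists #|` A|, A; split=> //; have [[kA _ _] _ _] := aA; lia.
Qed.

End GraphInterface.

Lemma automorphism_rev V (E : V -> V -> Prop) f :
  automorphism V E f -> automorphism V (rev_graph E) f.
Proof.
move=> [[f' [fK f'K]] fE]; split; first by exists f'.
move=> x y; split=> [yx|[z [zx <-]]].
  have /fE[z [yz fz]] : nbr V E (f (f' y)) (f x) by rewrite f'K.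
  exists (f' y); split; last exact: f'K.
  by have -> : x = z by rewrite -(fK x) -fz fK.
by apply/(fE z); exists x.
Qed.

(** * Degrees and blocks from the graph and its reverse together *)

Section Graph.
Variables (V : Type) (E : V -> V -> Prop).
Local Notation K := {classic V}.
Variables (g h : K -> {fset K}) (kap kap' : nat).
Hypotheses (gE : forall x y, y \in g x <-> E x y)
  (hE : forall x y, y \in h x <-> rev_graph E x y).
Hypotheses (E_refl : reflexive_graph V E) (E_trans : vertex_transitive V E).
Hypotheses (k1 : is_kappa V E 1 kap) (k2 : is_kappa V E 2 kap).
Hypotheses (k1' : is_kappa V (rev_graph E) 1 kap') (k2' : is_kappa V (rev_graph E) 2 kap').

Lemma out_in x y : (y \in g x) = (x \in h y).
Proof. by apply/idP/idP => [/gE|/hE] xy; [apply/hE|apply/gE]. Qed.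

Lemma in_out x y : (y \in h x) = (x \in g y).
Proof. by rewrite out_in. Qed.

Lemma rev_refl : reflexive_graph V (rev_graph E).
Proof. exact: E_refl. Qed.

Lemma rev_trans : vertex_transitive V (rev_graph E).
Proof.
by move=> x y; have [f [fA fx]] := E_trans x y; exists f; split=> //; apply: automorphism_rev.
Qed.

Lemma kappa_rev (U : {fset K}) : (forall x, x \in U) -> kap' = kap.
Proof.
move=> fullU; have /(is_kappaE gE E_refl)[iso_g [X fX]] := k1.
have /(is_kappaE hE rev_refl)[iso_h [Y fY]] := k1'.
apply/eqP; rewrite eqn_leq (iso_reverse_leq out_in fullU iso_h fX).
exact: (iso_reverse_leq in_out fullU iso_g fY).
Qed.

(** A one-point 1-atom gives the degree directly. If instead its exterior is a point [w], the graph
    is finite and that point is a 1-fragment of the reverse graph, so [h w] has kap + 1 elements;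
    in- and out-degrees agree. *)
Lemma cauchy_degree (x : K) : cauchy V E -> #|` g x| = kap.+1.
Proof.
case=> [nsep|[S [aS cS]]].
  by case: nsep; have [[X [aX _]] _] := k1; exists X.
have [A eS] := admissible_fset (proj1 (proj1 aS)).
move: aS cS; rewrite eS => /(atomE gE E_refl k1)[fA _ _] [/card_pset c1|].
  have /eqP/cardfs1P[v eA] := c1; have [_ _] := fA; rewrite c1 eA nb1 => gv.
  by rewrite (degree_const gE E_trans x v) gv.
move=> /card_fset_of[W eW cW]; have /eqP/cardfs1P[w ew] := cW.
pose U := w |` nb g A.
have fullU z : z \in U.
  rewrite inE; case zA : (z \in nb g A); rewrite ?orbT // orbF.
  suff : pset W z by rewrite ew.
  by rewrite -eW => /(nbrsE gE); rewrite zA.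
have eWU : U `\` nb g A = [fset w].
  apply/fsetP => z; rewrite !inE; case zA : (z \in nb g A) => /=.
    apply/esym/negP => /eqP ez; suff : ~ pset W w by apply; rewrite ew /pset inE.
    by rewrite -eW; apply; apply/(nbrsE gE); rewrite -ez.
  by rewrite orbF.
have /(is_kappaE hE rev_refl)[iso_h _] := k1'.
rewrite (kappa_rev fullU) in iso_h.
have [_ _] := frag_compl out_in fullU iso_h fA; rewrite eWU nb1 cardfs1 => hw.
rewrite -[_.+1]hw; apply: (degree_count out_in fullU) => [y|y|].
- exact: (degree_const gE E_trans).
- exact: (degree_const hE rev_trans).
- by rewrite cardfs_gt0; apply/fset0Pn; exists w.
Qed.

(** If [A] is larger than its exterior, the graph is finite, and passing to complements gives b <=
    |ext A| < a <= |ext B|. So one of the two atoms is no larger than its exterior, and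
    [fatom1_block] applies to it. *)
Lemma atom1_is_block :
  (exists A, atom V E 1 A /\ block V E A) \/
  (exists A, atom V (rev_graph E) 1 A /\ block V (rev_graph E) A).
Proof.
have [a [A aA]] := fatom_exists_kappa gE E_refl k1.
have [b [B aB]] := fatom_exists_kappa hE rev_refl k1'.
have [fA|nfA] := pselect (far g a A).
  left; exists (pset A); split; first exact: (fatom_atom gE E_refl k1 aA).
  exact: (fatom1_block gE E_refl k1 aA).
have [U fullU] := far_finite nfA.
have /(is_kappaE gE E_refl)[iso_g _] := k1.
have /(is_kappaE hE rev_refl)[iso_h _] := k1'.
move: (k1') aB; rewrite (kappa_rev fullU) in iso_h * => k1B aB.
have [fA cA Amin] := aA; have [fB cB Bmin] := aB.
have /Bmin := frag_compl out_in fullU iso_h fA.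
have /Amin := frag_compl in_out fullU iso_g fB => leA leB.
right; exists (pset B); split; first exact: (fatom_atom hE rev_refl k1B aB).
apply: (fatom1_block hE rev_refl k1B aB).
apply/(far_compl _ fullU); apply: leq_trans leA; apply: leq_trans leB _.
by rewrite leqNgt; apply/negP => /ltnW aF; apply: nfA; apply/(far_compl _ fullU).
Qed.

(** Complementation exchanges the 2-fragments of both graphs and reverses the order of sizes, so the
    exterior [F] of a 2-atom is a 2-super-fragment of the reverse. Failure of faithfulness makes |F|
    < a, and [A] itself supplies the |F| + 1 far points needed by [superfrag_inter]. *)
Lemma superfragment_is_block : ~ faithful V E 2 ->
  exists F, super_fragment V (rev_graph E) 2 F /\ block V (rev_graph E) F.
Proof.
move=> nf; have [a [A aA]] := fatom_exists_kappa gE E_refl k2.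
have nfA := not_faithful gE E_refl k2 nf aA.
have [U fullU] := far_finite nfA; have ek := kappa_rev fullU.
have /(is_kappaE gE E_refl)[iso_g _] := k2.
have kh2 := k2'; have kh1 := k1'; rewrite ek in kh1 kh2.
have /(is_kappaE hE rev_refl)[iso_h _] := kh2.
have /(is_kappaE hE rev_refl)[iso_h1 _] := kh1.
have [fA cA Amin] := aA; pose F := U `\` nb g A.
have fF : frag h 2 kap F := frag_compl out_in fullU iso_h fA.
have Fa : #|` F| < a.
  by rewrite ltnNge; apply/negP => aF; apply: nfA; apply/(far_compl _ fullU).
have Fmax X : frag h 2 kap X -> #|` X| <= #|` F|.
  move=> fX; have := Amin _ (frag_compl in_out fullU iso_g fX).
  rewrite !(card_compl fullU); have [_ _ ->] := fX; have [_ _ ->] := fA.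
  by rewrite cA; lia.
exists (pset F); split; last first.
  apply: block_pset => f f_aut; have f_inj := aut_inj f_aut.
  apply: (superfrag_inter iso_h1 fF _ _ Fmax); last by apply: compl_far out_in _ _ _ _; lia.
    by apply: frag_aut => // x; apply: aut_nb.
  exact: card_aut.
split; first by exists #|` U|, (enum_fset U); split; [exact/NoDupE/fset_uniq|split=> // x; split=> // _; exact/InE].
split; first exact/(fragmentE hE rev_refl kh2).
exists #|` F|; split; first exact/card_pset.
move=> S b fS; have [X eS] := admissible_fset (proj1 fS).
by move: fS; rewrite eS => /(fragmentE hE rev_refl kh2)/Fmax Xb /card_pset <-; apply/leP.
Qed.

End Graph.

Unset Implicit Arguments.

Theorem theorem7p2 (V : Type) (E : V -> V -> Prop) :
  reflexive_graph V E ->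
  locally_finite V E ->
  vertex_transitive V E ->
  degenerate V E ->
  degenerate V (rev_graph E) ->
  (* (i) *)
  ((~ cauchy V E \/ ~ cauchy V (rev_graph E)) /\
   ((exists A, atom V E 1 A /\ block V E A) \/
    (exists A, atom V (rev_graph E) 1 A /\ block V (rev_graph E) A)))
  \/
  (* (ii) *)
  ((~ faithful V E 2 /\
      exists F, super_fragment V (rev_graph E) 2 F /\ block V (rev_graph E) F) \/
   (~ faithful V (rev_graph E) 2 /\
      exists F, super_fragment V E 2 F /\ block V E F))
  \/
  (* (iii) *)
  (faithful V E 2 /\ faithful V (rev_graph E) 2 /\
   cauchy V E /\ cauchy V (rev_graph E) /\
   ~ (exists x : V,
        (exists A1 A2 A3,
           atom V E 2 A1 /\ atom V E 2 A2 /\ atom V E 2 A3 /\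
           ~ set_eq V A1 A2 /\ ~ set_eq V A1 A3 /\ ~ set_eq V A2 A3 /\
           A1 x /\ A2 x /\ A3 x) /\
        (exists B1 B2 B3,
           atom V (rev_graph E) 2 B1 /\ atom V (rev_graph E) 2 B2 /\
           atom V (rev_graph E) 2 B3 /\
           ~ set_eq V B1 B2 /\ ~ set_eq V B1 B3 /\ ~ set_eq V B2 B3 /\
           B1 x /\ B2 x /\ B3 x)))
  \/
  (* (iv) *)
  ((forall A, atom V E 2 A -> card V A 2) \/
   (forall A, atom V (rev_graph E) 2 A -> card V A 2)).
Proof.
move=> E_refl E_lf E_trans [_ [kap [k2 k1]]] [_ [kap' [k2' k1']]].
have nbhd (R : V -> V -> Prop) : (forall x, finite V (fun y => R x y)) ->
    exists g : {classic V} -> {fset {classic V}}, forall x y, y \in g x <-> R x y.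
  move=> Rf; have /choice[g gR] : forall x : {classic V}, exists F : {fset {classic V}},
      (fun y => R x y) = pset F.
    by move=> x; have [n /card_fset_of[F eF _]] := Rf x; exists F.
  by exists g => x y; have -> : R x y = pset (g x) y by rewrite -gR.
have [g gE] := nbhd E (fun x => proj1 (E_lf x)).
have [h hE] := nbhd (rev_graph E) (fun x => proj2 (E_lf x)).
have [c|nc] := pselect (cauchy V E); last first.
  by left; split; [left|apply: (atom1_is_block gE hE E_refl k1 k1')].
have [c'|nc'] := pselect (cauchy V (rev_graph E)); last first.
  by left; split; [right|apply: (atom1_is_block gE hE E_refl k1 k1')].
right; have [f|nf] := pselect (faithful V E 2); last first.
  by left; left; split=> //; apply: (superfragment_is_block gE hE E_refl k1 k2 k1' k2').
have [f'|nf'] := pselect (faithful V (rev_graph E) 2); last first.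
  left; right; split=> //.
  exact: (superfragment_is_block hE gE (rev_refl E_refl) k1' k2' k1 k2).
right; have [a2|na2] := pselect (forall A, atom V E 2 A -> card V A 2); first by right; left.
have [b2|nb2] := pselect (forall A, atom V (rev_graph E) 2 A -> card V A 2).
  by right; right.
left; do 4!split=> //; move=> [x [tA tB]].
have [a [A [aA a_gt2]]] := atom_card_neq2 gE E_refl k2 na2.
have [b [B [aB b_gt2]]] := atom_card_neq2 hE (rev_refl E_refl) k2' nb2.
case: tA => A1 [A2 [A3 [p1 [p2 [p3 [q1 [q2 [q3 [x1 [x2 x3]]]]]]]]]].
case: tB => B1 [B2 [B3 [r1 [r2 [r3 [s1 [s2 [s3 [y1 [y2 y3]]]]]]]]]].
have gL := atoms_transport gE E_refl E_trans k2 aA p1 p2 p3 q1 q2 q3 x1 x2 x3.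
have hL := atoms_transport hE (rev_refl E_refl) (rev_trans E_trans) k2' aB
  r1 r2 r3 s1 s2 s3 y1 y2 y3.
have two (g0 : {classic V} -> {fset {classic V}}) n c0 : (forall (y : {classic V}) A, exists L1 L2,
    [/\ fatom g0 2 n c0 L1, fatom g0 2 n c0 L2, y \in L1 & y \in L2] /\
    [/\ L1 <> L2, L1 <> A & L2 <> A]) ->
    forall (y : {classic V}) A, exists L, [/\ fatom g0 2 n c0 L, y \in L & L <> A].
  by move=> L3 y X; have [L [_ [[l _ yL _] [_ nL _]]]] := L3 y X; exists L.
have gd y := cauchy_degree gE hE E_refl E_trans k1 k1' y c.
have hd y := cauchy_degree hE gE (rev_refl E_refl) (rev_trans E_trans) k1' k1 y c'.
have /(is_kappaE gE E_refl)[giso _] := k1.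
have /(is_kappaE hE (rev_refl E_refl))[hiso _] := k1'.
have gfar X := faithful_fatom gE E_refl k2 (a := a) (A := X) f.
have hfar X := faithful_fatom hE (rev_refl E_refl) k2' (a := b) (A := X) f'.
(* The crossing argument takes the smaller 2-atoms on the side of its first graph, so the graph and
   its reverse are exchanged when b < a. *)
have [ab|ba] := leqP a b.
  exact: (too_many_lines (out_in gE hE) gd hd giso hiso gfar hfar ab a_gt2 (two _ _ _ hL) gL x).
exact: (too_many_lines (in_out gE hE) hd gd hiso giso hfar gfar (ltnW ba) b_gt2
  (two _ _ _ gL) hL x).
Qed.
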